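(* Let $R=\mathbb K[x_0,\dots,x_n]$ with $\mathbb K$ a field (i.e. $A=\mathbb K$). Let $J\subset R$ be a quasi-stable but not stable ideal, and let $I\subset R$ be an ideal generated by a $J$-marked basis $F$ such that the $J$-resolution of $I$ is minimal. Then, for any term order $\prec$, the $J$-marked basis $F$ of $I$ is not a Gröbner basis of $I$ with initial ideal $J$.
   Context: $R$ has the standard grading and $x_0<\dots<x_n$. A term of $R$ is a monomial $x^\alpha$; for $x^\alpha\neq1$, $\min(x^\alpha)$ is the smallest variable dividing it. Variables $x_i>\min(x^\alpha)$ are non-multiplicative for $x^\alpha$ (the term $1$ has no non-multiplicative variables). The same notions apply to terms $x^\alpha\mathbf e_k$ of a graded free module $\bigoplus_kR(-d_k)\mathbf e_k$ (using $x^\alpha$). For a monomial submodule (or ideal) $U$, $\mathcal N(U)$ is the set of terms not in $U$. Pommaret cone: $\mathcal C(x^\alpha)=\{x^\delta x^\alpha\mid\delta_i=0\ \forall x_i>\min(x^\alpha)\}$ for $x^\alpha\neq 1$, $\mathcal C(1)=$ all terms, $\mathcal C(x^\alpha\mathbf e_k)=\mathcal C(x^\alpha)\mathbf e_k$. A Pommaret basis of $U$ is a set of terms generating $U$ whose cones partition the set of terms of $U$; it is unique if it exists, denoted $\mathcal P_U$. $U$ is quasi-stable if it has a finite Pommaret basis, stable if moreover $\mathcal P_U$ is its minimal monomial generating set. A $U$-marked set is a finite set $F=\{f_\tau\}_{\tau\in\mathcal P_U}$ of homogeneous elements such that $\tau$ has coefficient $1$ in $f_\tau$ and the support of $f_\tau-\tau$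 is contained in $\mathcal N(U)$. It is a $U$-marked basis if, for all $s$, the degree-$s$ part of the ambient free module is $(F)_s\oplus\langle\mathcal N(U)_s\rangle_{\mathbb K}$. Then each $f\in(F)$ has a unique writing $f=\sum_{\tau\in\mathcal P_U} P_\tau f_\tau$ with $P_\tau\in R$ and all terms of $P_\tau\tau$ in $\mathcal C(\tau)$. $U$-resolution of $M=(F)$: let $P_0=\bigoplus_{\tau\in\mathcal P_U}R(-\deg\tau)\mathbf f_\tau$ and $\partial_0(\mathbf f_\tau)=f_\tau$. For $\tau\in\mathcal P_U$ and $x_i$ non-multiplicative for $\tau$, the fundamental syzygy is $S_{i,\tau}=x_i\mathbf f_\tau-\sum P_\sigma\mathbf f_\sigma$, where $x_if_\tau=\sum P_\sigma f_\sigma$ is the unique writing. The set $F^{\partial_1}$ of fundamental syzygies is a marked basis (head term of $S_{i,\tau}$: $x_i\mathbf f_\tau$) of $\ker\partial_0$ over the stable module with Pommaret basis $\{x_i\mathbf f_\tau\mid x_i\text{ non-multiplicative for }\tau\}$. Iterating (known), $F^{\partial_t}$, the set of fundamental syzygies of $F^{\partial_{t-1}}$ (with $F^{\partial_0}=F$), is a marked basis of $\ker\partial_{t-1}$ over a stable module, and $\partial_t:P_t\to P_{t-1}$ is the homomorphism whose matrix has the elements of $F^{\partial_t}$ as columns. The resulting finite graded free resolution is the $U$-resolution of $M$ (here $U=J$, $M=I$). It is minimal if no matrix entry of $\partial_t$, $t\geq1$, is a non-zero constant. *)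

(* Defs.v *)
From Stdlib Require Import ClassicalEpsilon.
From HB Require Import structures.
From mathcomp Require Import all_boot all_order all_algebra.
From mathcomp Require Import finmap.
From mathcomp Require Import mpoly.

Set Implicit Arguments.
Unset Strict Implicit.
Unset Printing Implicit Defensive.

Import GRing.Theory.
Local Open Scope ring_scope.

(* The ring K[x_0, ..., x_n] is {mpoly K[n.+1]}, its terms are the monomials
   'X_{1..n.+1}, and the variables are ordered by their indices.  Ideals and
   sets of polynomials are Prop-valued predicates. *)

Definition ideal_gen (K : fieldType) (n : nat) (S : {mpoly K[n.+1]} -> Prop)
    (f : {mpoly K[n.+1]}) : Prop :=
  exists s : seq ({mpoly K[n.+1]} * {mpoly K[n.+1]}),
    (forall p, p \in s -> S p.2) /\ f = \sum_(p <- s) p.1 * p.2.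

Definition monomial_gen (K : fieldType) (n : nat) (S : 'X_{1..n.+1} -> Prop) :
    {mpoly K[n.+1]} -> Prop :=
  ideal_gen (fun f => exists2 m, S m & f = 'X_[m]).

Definition in_N (K : fieldType) (n : nat) (J : {mpoly K[n.+1]} -> Prop)
    (m : 'X_{1..n.+1}) : Prop :=
  ~ J 'X_[m].

(* Index of the smallest variable dividing m; None exactly when m is 1. *)
Definition min_var (n : nat) (m : 'X_{1..n.+1}) : option 'I_n.+1 :=
  [pick i : 'I_n.+1 | (m i != 0%N) &&
     [forall j : 'I_n.+1, (m j != 0%N) ==> (i <= j)%N]].

Definition nonmult (n : nat) (m : 'X_{1..n.+1}) (i : 'I_n.+1) : bool :=
  if min_var m is Some j then (j < i)%N else false.

Definition cone (n : nat) (t m : 'X_{1..n.+1}) : Prop :=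
  exists d : 'X_{1..n.+1},
    (forall i, nonmult t i -> d i = 0%N) /\ m = (d + t)%MM.

Definition pommaret_basis (K : fieldType) (n : nat)
    (J : {mpoly K[n.+1]} -> Prop) (P : {fset 'X_{1..n.+1}}) : Prop :=
  [/\ forall f, J f <-> monomial_gen (fun m => m \in P) f,
      forall m, J 'X_[m] <-> exists2 t, t \in P & cone t m
    & forall t u m, t \in P -> u \in P -> cone t m -> cone u m -> t = u].

(* This entails that J is a monomial ideal. *)
Definition quasi_stable (K : fieldType) (n : nat)
    (J : {mpoly K[n.+1]} -> Prop) : Prop :=
  exists P : {fset 'X_{1..n.+1}}, pommaret_basis J P.

Definition minimal_monomial_gens (K : fieldType) (n : nat)
    (J : {mpoly K[n.+1]} -> Prop) (G : {fset 'X_{1..n.+1}}) : Prop :=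
  (forall f, J f <-> monomial_gen (fun m => m \in G) f) /\
  (forall H : {fset 'X_{1..n.+1}},
     (forall m, m \in H -> m \in G) ->
     (forall f, J f <-> monomial_gen (fun m => m \in H) f) -> H = G).

Definition stable (K : fieldType) (n : nat)
    (J : {mpoly K[n.+1]} -> Prop) : Prop :=
  exists P : {fset 'X_{1..n.+1}},
    pommaret_basis J P /\ minimal_monomial_gens J P.

Definition marked_set (K : fieldType) (n : nat)
    (J : {mpoly K[n.+1]} -> Prop) (P : {fset 'X_{1..n.+1}})
    (F : P -> {mpoly K[n.+1]}) : Prop :=
  forall t : P,
    [/\ exists d : nat, F t \is d.-homog,
        (F t)@_(val t) = 1
      & forall m, m \in msupp (F t - 'X_[val t]) -> in_N J m].

Definition fam_ideal (K : fieldType) (n : nat) (P : {fset 'X_{1..n.+1}})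
    (F : P -> {mpoly K[n.+1]}) : {mpoly K[n.+1]} -> Prop :=
  ideal_gen (fun f => exists t : P, f = F t).

(* The last two clauses say that R_s is the direct sum of (F)_s and of the
   K-span of the terms of degree s outside J. *)
Definition marked_basis (K : fieldType) (n : nat)
    (J : {mpoly K[n.+1]} -> Prop) (P : {fset 'X_{1..n.+1}})
    (F : P -> {mpoly K[n.+1]}) : Prop :=
  [/\ marked_set J F,
      forall (s : nat) (f : {mpoly K[n.+1]}), f \is s.-homog ->
        exists g h : {mpoly K[n.+1]},
          [/\ f = g + h, g \is s.-homog /\ fam_ideal F g, h \is s.-homog
            & forall m, m \in msupp h -> in_N J m]
    & forall (s : nat) (f : {mpoly K[n.+1]}), f \is s.-homog ->
        fam_ideal F f -> (forall m, m \in msupp f -> in_N J m) -> f = 0].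

(* A finite family, indexed by mf_idx, of elements of the free module with
   basis mf_rk; mf_head gives the head term x^m e_k of an element as (k, m). *)
Record marked_family (K : fieldType) (n : nat) := MarkedFamily {
  mf_rk : finType;
  mf_idx : finType;
  mf_head : mf_idx -> mf_rk * 'X_{1..n.+1};
  mf_elt : mf_idx -> {ffun mf_rk -> {mpoly K[n.+1]}} }.

Definition is_writing (K : fieldType) (n : nat) (M : marked_family K n)
    (g : {ffun mf_rk M -> {mpoly K[n.+1]}})
    (P : {ffun mf_idx M -> {mpoly K[n.+1]}}) : Prop :=
  (forall h m, m \in msupp (P h) ->
     cone (mf_head h).2 (m + (mf_head h).2)%MM) /\
  (forall k, g k = \sum_h P h * mf_elt h k).

(* Chosen by epsilon; for a marked basis and g in the module it generates, the
   writing exists and is unique. *)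
Definition writing (K : fieldType) (n : nat) (M : marked_family K n)
    (g : {ffun mf_rk M -> {mpoly K[n.+1]}}) :
    {ffun mf_idx M -> {mpoly K[n.+1]}} :=
  epsilon (inhabits [ffun=> 0]) (is_writing g).

Definition fund_syzygy (K : fieldType) (n : nat) (M : marked_family K n)
    (h : mf_idx M) (i : 'I_n.+1) : {ffun mf_idx M -> {mpoly K[n.+1]}} :=
  let P := writing [ffun k => 'X_i * mf_elt h k] in
  [ffun h' => (if h' == h then 'X_i else 0) - P h'].

Definition syzygy_family (K : fieldType) (n : nat) (M : marked_family K n) :
    marked_family K n :=
  @MarkedFamily K n (mf_idx M)
    {p : mf_idx M * 'I_n.+1 | nonmult (mf_head p.1).2 p.2}
    (fun q => ((val q).1, U_((val q).2)%MM))
    (fun q => fund_syzygy (val q).1 (val q).2).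

(* The ring is seen as the free module with basis unit. *)
Definition ideal_family (K : fieldType) (n : nat) (P : {fset 'X_{1..n.+1}})
    (F : P -> {mpoly K[n.+1]}) : marked_family K n :=
  @MarkedFamily K n unit P (fun t => (tt, val t)) (fun t => [ffun=> F t]).

(* The elements of U_resolution F t are the columns of the matrix of the t-th
   differential; t = 0 gives the augmentation onto the ideal (F). *)
Definition U_resolution (K : fieldType) (n : nat) (P : {fset 'X_{1..n.+1}})
    (F : P -> {mpoly K[n.+1]}) (t : nat) : marked_family K n :=
  iter t (@syzygy_family K n) (ideal_family F).

Definition minimal_U_resolution (K : fieldType) (n : nat)
    (P : {fset 'X_{1..n.+1}}) (F : P -> {mpoly K[n.+1]}) : Prop :=
  forall (t : nat) (h : mf_idx (U_resolution F t))
         (k : mf_rk (U_resolution F t)) (c : K),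
    (1 <= t)%N -> c != 0 -> mf_elt h k <> c%:MP.

Definition term_order (n : nat) (le : rel 'X_{1..n.+1}) : Prop :=
  [/\ antisymmetric le, transitive le, total le,
      forall m, le 0%MM m
    & forall m1 m2 m, le m1 m2 -> le (m1 + m)%MM (m2 + m)%MM].

(* The zero polynomial has no leading term. *)
Definition leading_term (K : fieldType) (n : nat) (le : rel 'X_{1..n.+1})
    (f : {mpoly K[n.+1]}) (m : 'X_{1..n.+1}) : Prop :=
  m \in msupp f /\ forall m', m' \in msupp f -> le m' m.

Definition initial_ideal (K : fieldType) (n : nat) (le : rel 'X_{1..n.+1})
    (I : {mpoly K[n.+1]} -> Prop) : {mpoly K[n.+1]} -> Prop :=
  monomial_gen (fun m => exists2 f, I f & leading_term le f m).

Definition groebner_basis (K : fieldType) (n : nat) (le : rel 'X_{1..n.+1})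
    (I S : {mpoly K[n.+1]} -> Prop) : Prop :=
  (forall f, S f -> I f) /\
  (forall f, initial_ideal le I f <->
     monomial_gen (fun m => exists2 g, S g & leading_term le g m) f).

(* Main.v *)
Require Import Defs.
From mathcomp Require Import all_boot all_order all_algebra.
From mathcomp Require Import finmap.
From mathcomp Require Import mpoly.
From Stdlib Require Import ClassicalEpsilon.

(** A Pommaret basis that is not the minimal generating set contains two terms
    [t] and [u = x_i t] with [x_i] non-multiplicative for [t]
    ([pommaret_nonmult_chain]).  Suppose that the initial ideal of [(F)] is [J].
    The tail of a marked polynomial avoids [J], so the leading term of [F t] is
    its head [t] ([marked_leading_term]), and the leading term of [x_i (F t)]
    is [u].

    Write [x_i (F t)] as the sum of the [W v * F v], each [W v] having its terms
    in the cone of [v].  The heads [a v], with [a] a term of [W v], are pairwise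
    distinct because the cones are disjoint; the largest one therefore survives
    in the sum and equals the leading term [u] ([cone_sum_leading]).  Since [u]
    lies in its own cone, it can only come from [v = u] and [a = 1].  All other
    terms [b] of [W u] satisfy [b u <= u], hence [b <= 1], so [W u] is a nonzero
    constant.  It is, up to sign, an entry of the first syzygy [S_(i,t)], and
    the resolution is not minimal.

    The writing of [x_i (F t)] used by the fundamental syzygy is selected by the
    epsilon operator, so one writing has to be produced before anything is known
    about the selected one.  Reduction along the term order produces it
    ([cone_writing_exists]); the argument above applies to every writing. *)

Set Implicit Arguments.
Unset Strict Implicit.
Unset Printing Implicit Defensive.

Import GRing.Theory.
Local Open Scope ring_scope.

(** * Ideals generated by terms *)

Lemma nonmult_up (n : nat) (m : 'X_{1..n.+1}) (i k : 'I_n.+1) :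
  nonmult m i -> (i <= k)%N -> nonmult m k.
Proof.
by rewrite /nonmult; case: (min_var m) => // j ji ik; apply: leq_trans ik.
Qed.

Lemma mem_msuppXM (K : fieldType) (n : nat) (d m : 'X_{1..n.+1})
    (f : {mpoly K[n.+1]}) :
  m \in msupp ('X_[d] * f) -> exists2 k, k \in msupp f & m = (d + k)%MM.
Proof.
rewrite mulrC (perm_mem (msuppMX f d)) => /mapP [k kf ->].
by exists k.
Qed.

Lemma ideal_gen_incl (K : fieldType) (n : nat)
    (S : {mpoly K[n.+1]} -> Prop) (a f : {mpoly K[n.+1]}) :
  S f -> ideal_gen S (a * f).
Proof.
move=> Sf; exists [:: (a, f)]; split; last by rewrite big_seq1.
by move=> p; rewrite inE => /eqP ->.
Qed.

Lemma ideal_genD (K : fieldType) (n : nat)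
    (S : {mpoly K[n.+1]} -> Prop) (f g : {mpoly K[n.+1]}) :
  ideal_gen S f -> ideal_gen S g -> ideal_gen S (f + g).
Proof.
move=> [s [Ss ->]] [r [Sr ->]]; exists (s ++ r); split; last by rewrite big_cat.
by move=> p; rewrite mem_cat => /orP [/Ss|/Sr].
Qed.

Lemma ideal_genMl (K : fieldType) (n : nat)
    (S : {mpoly K[n.+1]} -> Prop) (a f : {mpoly K[n.+1]}) :
  ideal_gen S f -> ideal_gen S (a * f).
Proof.
move=> [s [Ss ->]]; exists [seq (a * p.1, p.2) | p <- s]; split.
  by move=> p /mapP [q /Ss Sq ->].
by rewrite big_map mulr_sumr; apply: eq_bigr => p _; rewrite mulrA.
Qed.

Lemma monomial_gen_dvd (K : fieldType) (n : nat)
    (S : 'X_{1..n.+1} -> Prop) (u m : 'X_{1..n.+1}) :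
  S u -> (u <= m)%MM -> monomial_gen S ('X_[m] : {mpoly K[n.+1]}).
Proof.
move=> Su um; rewrite -(submK um) mpolyXD.
by apply: ideal_gen_incl; exists u.
Qed.

Lemma monomial_genX (K : fieldType) (n : nat)
    (S : 'X_{1..n.+1} -> Prop) (m : 'X_{1..n.+1}) :
  monomial_gen S ('X_[m] : {mpoly K[n.+1]}) -> exists2 u, S u & (u <= m)%MM.
Proof.
move=> [s [Ss e]]; apply: NNPP => noS.
suff : ('X_[m] : {mpoly K[n.+1]})@_m = 0.
  by rewrite mcoeffX eqxx => /eqP; rewrite oner_eq0.
rewrite e raddf_sum big_seq big1 // => p /[dup] ps /Ss [u Su pu].
apply: memN_msupp_eq0; apply/negP; rewrite pu mulrC => /mem_msuppXM [k _ mk].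
by apply: noS; exists u => //; rewrite mk lem_addr.
Qed.

(** * Non-minimal Pommaret bases *)

(** If the basis is not minimal, some [u] in it has a variable [x_i] with
    [u / x_i] in [J]; take the smallest such [x_i], and let [t] be the basis term
    whose cone contains [u / x_i], say [u = x_i d t].  Then [x_i] is
    non-multiplicative for [t], as otherwise [u] would lie in the cone of [t].
    Any variable of [d] could be removed from [u] as well, so it is at least
    [x_i], yet it is multiplicative for [t]; hence [d = 1]. *)
Lemma pommaret_nonmult_chain (K : fieldType) (n : nat)
    (J : {mpoly K[n.+1]} -> Prop) (P : {fset 'X_{1..n.+1}}) :
  pommaret_basis J P -> ~ stable J ->
  exists (t u : P) (i : 'I_n.+1),
    nonmult (val t) i /\ val u = (U_(i) + val t)%MM.
Proof.
move=> PB nst; have [Jgen Jcone disj] := PB.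
apply: NNPP => nopair; apply: nst; exists P; split=> //; split=> // H HP Hgen.
apply/fsetP => u; apply/idP/idP => [/HP //|uP].
have [v vH vu] : exists2 v, v \in H & (v <= u)%MM.
  apply: (@monomial_genX K n (fun m => m \in H)); apply/Hgen/Jgen.
  exact: (@monomial_gen_dvd K n (fun m => m \in P)) uP (lepm_refl _).
have [<- //|vNu] := eqVneq v u; exfalso; apply: nopair.
pose inJ m := [exists w : P, (val w <= m)%MM].
have inJP m w : w \in P -> (w <= m)%MM -> inJ m.
  by move=> wP wm; apply/existsP; exists [` wP]%fset.
have inJ_J m : inJ m -> J 'X_[m].
  move=> /existsP [w wm]; apply/Jgen.
  exact: (@monomial_gen_dvd K n (fun m => m \in P)) (valP w) wm.
pose removable (i : 'I_n.+1) := (0 < u i)%N && inJ (u - U_(i))%MM.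
have [i0 i0u] : exists i, (v i < u i)%N.
  apply/existsP; apply: contraR vNu; rewrite negb_exists => /forallP uv.
  apply/eqP/mnmP => i; apply/eqP; rewrite eqn_leq (mnm_lepP vu) /=.
  by rewrite leqNgt uv.
have rem0 : removable i0.
  apply/andP; split; first exact: leq_ltn_trans i0u.
  apply: inJP (HP _ vH) _; apply/mnm_lepP => k; rewrite mnmBE mnm1E.
  have := mnm_lepP vu k; case: eqP => [<- _|_]; last by rewrite subn0.
  by move: i0u; case: (u i0) => // c; rewrite subSS subn0.
case: (arg_minnP (fun i : 'I_n.+1 => i : nat) rem0) => i ri imin.
have /andP [ui /inJ_J Ji] := ri.
have U_le : (U_(i) <= u)%MM.
  by apply/mnm_lepP => k; rewrite mnm1E; case: eqP => // <-.
have [t tP [d [dt ut]]] := (Jcone _).1 Ji.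
have ue : u = (U_(i) + (d + t))%MM by rewrite -ut addmC submK.
have nmi : nonmult t i.
  apply/negP => mi; have tu : t = u.
    apply: (disj _ _ u) => //.
      exists (U_(i) + d)%MM; split; last by rewrite -addmA.
      move=> k nk; rewrite mnmDE mnm1E dt // addn0.
      by case: eqP nk => // <- /mi.
    by exists 0%MM; split=> [k _|]; rewrite ?mnm0E ?add0m.
  have e := congr1 mdeg ue; rewrite !mdegD mdeg1 tu in e.
  by have := ltnn (mdeg u); rewrite {2}e add1n ltnS leq_addl.
have d0 : d = 0%MM.
  apply/mnmP => k; rewrite mnm0E; apply/eqP; rewrite -leqn0 leqNgt.
  apply/negP => dk.
  have uk : (0 < u k)%N by rewrite ue !mnmDE addnCA ltn_addr.
  suff /imin ik : removable k.
    by move: dk; rewrite (dt _ (nonmult_up nmi ik)).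
  rewrite /removable uk; apply: inJP tP _.
  apply/mnm_lepP => l; rewrite mnmBE ue !mnmDE [U_(k)%MM l]mnm1E.
  have [<-|_] := eqVneq k l; last by rewrite subn0 addnA leq_addl.
  by case: (d k) dk => // c _; rewrite addSn addnS subn1 /= addnA leq_addl.
exists [` tP]%fset, [` uP]%fset, i; split=> //=.
by rewrite ue d0 add0m.
Qed.

(** * Leading terms *)

Lemma term_order_max (n : nat) (le : rel 'X_{1..n.+1})
    (s : seq 'X_{1..n.+1}) :
  term_order le -> s != [::] ->
  exists m, m \in s /\ forall m', m' \in s -> le m' m.
Proof.
move=> [_ tr tot _ _].
have refl x : le x x by have := tot x x; rewrite orbb.
elim: s => // a [|b s] IH _.
  by exists a; split=> [|m']; rewrite inE // => /eqP ->.
have [//|m [ms mmax]] := IH; case/orP: (tot a m) => am.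
  exists m; split=> [|m']; first by rewrite inE ms orbT.
  by rewrite inE => /orP [/eqP -> //|/mmax].
exists a; split=> [|m']; first by rewrite inE eqxx.
by rewrite inE => /orP [/eqP -> //|/mmax mm]; apply: tr mm am.
Qed.

Lemma leading_term_exists (K : fieldType) (n : nat) (le : rel 'X_{1..n.+1})
    (f : {mpoly K[n.+1]}) :
  term_order le -> f != 0 -> exists m, leading_term le f m.
Proof. by move=> ord; rewrite -msupp_eq0; apply: term_order_max. Qed.

Lemma term_order_add_eq (n : nat) (le : rel 'X_{1..n.+1})
    (a b c : 'X_{1..n.+1}) :
  term_order le -> le b c -> le (a + c)%MM (a + b)%MM -> b = c.
Proof.
move=> [anti _ _ _ mono] bc cb; apply: (@addmI _ a); apply: anti.
by rewrite cb andbT ![(a + _)%MM]addmC mono.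
Qed.

Lemma leading_termMX (K : fieldType) (n : nat) (le : rel 'X_{1..n.+1})
    (f : {mpoly K[n.+1]}) (d m : 'X_{1..n.+1}) :
  term_order le -> leading_term le f m ->
  leading_term le ('X_[d] * f) (d + m)%MM.
Proof.
move=> [_ _ _ _ mono] [mf mmax]; split.
  by rewrite mulrC mcoeff_msupp mcoeffMX -mcoeff_msupp.
move=> _ /mem_msuppXM [k kf ->]; rewrite ![(d + _)%MM]addmC.
exact/mono/mmax.
Qed.

(** * Writings supported in cones *)

Definition cone_supported (K : fieldType) (n : nat)
    (P : {fset 'X_{1..n.+1}}) (Q : P -> {mpoly K[n.+1]}) : Prop :=
  forall t a, a \in msupp (Q t) -> cone (val t) (a + val t)%MM.

(** The heads [a * t], with [a] a term of [Q t], are pairwise distinct because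
    the cones are disjoint.  Every term of the sum is at most some head, and the
    largest head arises only once, so it cannot cancel. *)
Lemma cone_sum_leading (K : fieldType) (n : nat) (le : rel 'X_{1..n.+1})
    (P : {fset 'X_{1..n.+1}}) (F Q : P -> {mpoly K[n.+1]})
    (m : 'X_{1..n.+1}) :
  term_order le ->
  (forall t u m, t \in P -> u \in P -> cone t m -> cone u m -> t = u) ->
  (forall t, leading_term le (F t) (val t)) ->
  cone_supported Q ->
  leading_term le (\sum_t Q t * F t) m ->
  (forall t a, a \in msupp (Q t) -> le (a + val t)%MM m) /\
  exists t a, a \in msupp (Q t) /\ (a + val t)%MM = m.
Proof.
move=> ord disj lead Qc [mS mmax]; have [anti tr _ _ _] := ord.
have coefE c : (\sum_t Q t * F t)@_c =
    \sum_t \sum_(a <- msupp (Q t)) (Q t)@_a * ('X_[a] * F t)@_c.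
  rewrite raddf_sum; apply: eq_bigr => t _ /=.
  rewrite {1}[Q t]mpolyE mulr_suml raddf_sum; apply: eq_bigr => a _ /=.
  by rewrite -scalerAl mcoeffZ.
have [t1 [a1 [a1Q ma1]]] : exists t a,
    a \in msupp (Q t) /\ m \in msupp ('X_[a] * F t).
  apply: NNPP => none; move: mS; rewrite mcoeff_msupp coefE => /eqP; apply.
  rewrite big1 // => t _; rewrite big_seq big1 // => a aQ.
  rewrite [X in _ * X]memN_msupp_eq0 ?mulr0 //; apply/negP => ma.
  by apply: none; exists t, a.
have m_le1 : le m (a1 + val t1)%MM.
  by case: (leading_termMX a1 ord (lead t1)) => _; apply.
pose heads := [seq (a + val t)%MM | t <- enum {: P}, a <- msupp (Q t)].
have headsP t a : a \in msupp (Q t) -> (a + val t)%MM \in heads.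
  by move=> aQ; apply/allpairsPdep; exists t, a; rewrite mem_enum.
have [t0 [a0 [a0Q top]]] : exists t0 a0, a0 \in msupp (Q t0) /\
    forall t a, a \in msupp (Q t) -> le (a + val t)%MM (a0 + val t0)%MM.
  have heads0 : heads != [::].
    by apply: contraTneq (headsP _ _ a1Q) => ->.
  have [_ [/allpairsPdep [t0 [a0 [_ a0Q ->]]] hmax]] :=
    term_order_max ord heads0.
  by exists t0, a0; split=> // t a /headsP /hmax.
suff em : (a0 + val t0)%MM = m.
  by rewrite -em; split=> //; exists t0, a0.
apply: anti; apply/andP; split; last exact: tr m_le1 (top _ _ a1Q).
apply: mmax; rewrite mcoeff_msupp coefE.
(* A contribution to the coefficient of the largest head must come from a
   leading term, and then disjointness of the cones identifies its source. *)
have vanish t a : a \in msupp (Q t) -> (t, a) != (t0, a0) ->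
    ('X_[a] * F t)@_(a0 + val t0)%MM = 0.
  move=> aQ neq; apply: memN_msupp_eq0; apply/negP => /mem_msuppXM [b bF e].
  have bt : b = val t.
    apply: (term_order_add_eq (a := a) ord); first by case: (lead t) => _; apply.
    by rewrite -e top.
  case/eqP: neq; move: e; rewrite bt => e.
  have tt0 : t = t0.
    apply: val_inj; apply: (disj _ _ (a0 + val t0)%MM) => //; try exact: valP.
      by rewrite e; apply: Qc.
    exact: Qc.
  by move: e; rewrite tt0 => /addIm ->.
rewrite (bigD1 t0) //= [X in _ + X]big1 ?addr0 => [|t tt0]; last first.
  rewrite big_seq big1 // => a aQ; rewrite vanish ?mulr0 //.
  by apply: contraNneq tt0 => -[->].
rewrite (bigD1_seq a0) //= big_seq_cond big1 ?addr0.
  rewrite mulf_neq0 //; first by rewrite -mcoeff_msupp.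
  by rewrite mulrC mcoeffMX -mcoeff_msupp; case: (lead t0).
move=> a /andP [aQ aa0]; rewrite vanish ?mulr0 //.
by apply: contraNneq aa0 => -[->].
Qed.

(** Reduction: as long as [f] is nonzero its leading term lies in the cone of
    some [t], and subtracting the matching multiple of [F t] lowers it.
    Homogeneity makes this stop, since there are finitely many terms of a given
    degree. *)
Lemma cone_writing_exists (K : fieldType) (n : nat) (le : rel 'X_{1..n.+1})
    (P : {fset 'X_{1..n.+1}}) (F : P -> {mpoly K[n.+1]})
    (s : nat) (f : {mpoly K[n.+1]}) :
  term_order le ->
  (forall t, exists d, F t \is d.-homog) ->
  (forall t, leading_term le (F t) (val t)) ->
  (forall g m, fam_ideal F g -> leading_term le g m ->
     exists2 t, t \in P & cone t m) ->
  f \is s.-homog -> fam_ideal F f ->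
  exists Q : {ffun P -> {mpoly K[n.+1]}},
    cone_supported Q /\ f = \sum_t Q t * F t.
Proof.
move=> ord Fhom lead inJ; have [anti tr _ _ _] := ord.
pose below (m : 'X_{1..n.+1}) :=
  [set b : 'X_{1..n.+1 < s.+1} | le (bmnm b) m && (bmnm b != m)].
have : forall m, m \in msupp f ->
    (#|below m| < #|{: 'X_{1..n.+1 < s.+1}}|.+1)%N.
  by move=> m _; rewrite ltnS max_card.
move: (#|_|.+1) => N bN.
(* The induction is on a strict bound [N] for the number of terms below any
   term of [f]. *)
elim: N f bN => [|N IH] f bN fhom fI.
  exists [ffun=> 0]; split=> [t a|]; first by rewrite ffunE msupp0.
  rewrite big1 => [|t _]; last by rewrite ffunE mul0r.
  apply/eqP; rewrite -msupp_eq0; case: (msupp f) bN => // m r /(_ m).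
  by rewrite inE eqxx => /(_ isT).
have [->|f0] := eqVneq f 0.
  exists [ffun=> 0]; split=> [t a|]; first by rewrite ffunE msupp0.
  by rewrite big1 // => t _; rewrite ffunE mul0r.
have [m fm] := leading_term_exists ord f0; have [mf mmax] := fm.
have [t0 t0P [d [dt em]]] := inJ _ _ fI fm.
pose t : P := [` t0P]%fset; have tE : val t = t0 by [].
have [Fm Fmax] := leading_termMX d ord (lead t); rewrite tE -em in Fm Fmax.
pose c := f@_m / (F t)@_t0.
have Ft0 : (F t)@_t0 != 0 by rewrite -mcoeff_msupp -tE; case: (lead t).
pose g := f - c *: 'X_[d] * F t.
have gm0 : g@_m = 0.
  rewrite /g -scalerAl mcoeffB mcoeffZ em [_ * F t]mulrC mcoeffMX -em /c.
  by rewrite divfK // subrr.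
have mS : mdeg m = s by apply: (dhomog_mf fhom).
have ghom : g \is s.-homog.
  have [e Fe] := Fhom t; apply: rpredB => //; rewrite -scalerAl; apply: rpredZ.
  have -> : s = (mdeg d + e)%N.
    rewrite -mS em mdegD; congr addn; apply: (dhomog_mf Fe).
    by rewrite -tE; case: (lead t).
  by apply: dhomogM => //; rewrite dhomogX.
have gI : fam_ideal F g.
  apply: ideal_genD => //; rewrite -mulNr; apply: ideal_gen_incl.
  by exists t.
have gm m' : m' \in msupp g -> le m' m /\ m' != m.
  move=> m'g; split.
    move/msuppB_le: (m'g); rewrite mem_cat => /orP [/mmax //|].
    by rewrite -scalerAl => /msuppZ_le /Fmax.
  by apply: contraTneq m'g => ->; rewrite mcoeff_msupp gm0 eqxx.
have [m' m'g||//|Q [Qc gQ]] := IH g.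
- have [m'm m'Nm] := gm _ m'g; rewrite -ltnS.
  apply: leq_trans (bN _ mf); rewrite ltnS; apply: proper_card.
  apply/properP; split.
    apply/subsetP => b; rewrite !inE => /andP [bm' bNm'].
    rewrite (tr _ _ _ bm' m'm) /=; apply: contraNneq m'Nm => bm.
    by apply/eqP; apply: anti; rewrite m'm -bm.
  have m's : (mdeg m' < s.+1)%N by rewrite (dhomog_mf ghom m'g).
  by exists (BMultinom m's); rewrite !inE /= ?m'm ?m'Nm // eqxx andbF.
- exact: ghom.
exists [ffun u => Q u + (if u == t then c *: 'X_[d] else 0)]; split.
  move=> u a; rewrite ffunE => /msuppD_le; rewrite mem_cat => /orP [/Qc //|].
  case: eqP => [-> /msuppZ_le|_]; last by rewrite msupp0.
  by rewrite msuppX inE => /eqP ->; exists d.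
transitivity (g + c *: 'X_[d] * F t); first by rewrite /g subrK.
rewrite gQ; under [RHS]eq_bigr do rewrite ffunE mulrDl.
rewrite big_split /=; congr (_ + _); rewrite (bigD1 t) //= eqxx big1 ?addr0 //.
by move=> u /negbTE ->; rewrite mul0r.
Qed.

(** * Marked bases with initial ideal J *)

Lemma marked_leading_term (K : fieldType) (n : nat) (le : rel 'X_{1..n.+1})
    (J : {mpoly K[n.+1]} -> Prop) (P : {fset 'X_{1..n.+1}})
    (F : P -> {mpoly K[n.+1]}) (t : P) :
  term_order le -> marked_set J F ->
  (forall m, leading_term le (F t) m -> J 'X_[m]) ->
  leading_term le (F t) (val t).
Proof.
move=> ord mF inJ; have [_ Ft1 tail] := mF t.
have F0 : F t != 0.
  by apply/eqP => F0; move/eqP: Ft1; rewrite F0 mcoeff0 eq_sym oner_eq0.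
have [m Fm] := leading_term_exists ord F0.
have [<- //|mNt] := eqVneq m (val t).
case: (tail m); last exact: inJ.
rewrite mcoeff_msupp mcoeffB mcoeffX [val t == m]eq_sym (negbTE mNt).
rewrite subr0 -mcoeff_msupp.
by case: Fm.
Qed.

Theorem proposition3p9 (K : fieldType) (n : nat)
    (J I : {mpoly K[n.+1]} -> Prop) (PJ : {fset 'X_{1..n.+1}})
    (F : PJ -> {mpoly K[n.+1]})
    (J_quasi_stable : quasi_stable J)
    (J_not_stable : ~ stable J)
    (PJ_basis : pommaret_basis J PJ)
    (F_marked_basis : marked_basis J F)
    (I_gen : forall f : {mpoly K[n.+1]}, I f <-> fam_ideal F f)
    (F_minimal : minimal_U_resolution F) :
  forall le : rel 'X_{1..n.+1}, term_order le ->
    ~ (groebner_basis le I (fun f => exists t : PJ, f = F t) /\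
       (forall f : {mpoly K[n.+1]}, initial_ideal le I f <-> J f)).
Proof.
move=> le ord [_ inI]; have [_ Jcone disj] := PJ_basis.
have [mF _ _] := F_marked_basis.
have ltJ f m : fam_ideal F f -> leading_term le f m -> J 'X_[m].
  move=> fI fm; apply/inI; rewrite -['X_[m]]mul1r; apply: ideal_gen_incl.
  by exists m => //; exists f => //; apply/I_gen.
have FI t : fam_ideal F (F t).
  by rewrite -[F t]mul1r; apply: ideal_gen_incl; exists t.
have lead t : leading_term le (F t) (val t).
  by apply: marked_leading_term ord mF _ => m; apply: ltJ.
have [t [u [i [nmi ue]]]] := pommaret_nonmult_chain PJ_basis J_not_stable.
have xF_lead : leading_term le ('X_i * F t) (val u).
  by rewrite ue; apply: leading_termMX.
pose M := ideal_family F.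
pose g : {ffun unit -> {mpoly K[n.+1]}} :=
  [ffun k => 'X_i * mf_elt (t : mf_idx M) k].
have wP : is_writing (M := M) g (writing (M := M) g).
  apply: epsilon_spec.
  have [d Fd] : exists d, F t \is d.-homog by case: (mF t).
  have [|||||Q [Qc eQ]] :=
    @cone_writing_exists K n le PJ F (1 + d) ('X_i * F t) ord.
  - by move=> v; case: (mF v).
  - exact: lead.
  - by move=> h m hI /(ltJ _ _ hI) /Jcone.
  - by apply: dhomogM => //; rewrite dhomogX /= mdeg1.
  - exact: (ideal_genMl _ (FI t)).
  exists Q; split=> [v a /Qc //|k]; rewrite !ffunE eQ.
  by apply: eq_bigr => v _; rewrite ffunE.
pose W : {ffun PJ -> {mpoly K[n.+1]}} := writing (M := M) g.
have [Wc Wsum] : is_writing (M := M) g W := wP.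
have eW : 'X_i * F t = \sum_v W v * F v.
  have := Wsum tt; rewrite !ffunE => ->.
  by apply: eq_bigr => v _; rewrite ffunE.
have [top [v [a [aW eu]]]] :
    (forall v a, a \in msupp (W v) -> le (a + val v)%MM (val u)) /\
    exists v a, a \in msupp (W v) /\ (a + val v)%MM = val u.
  by apply: cone_sum_leading ord disj lead Wc _; rewrite -eW.
have vu : v = u.
  apply: val_inj; apply: (disj _ _ (val u)); try exact: valP.
    by rewrite -eu; apply: Wc.
  by exists 0%MM; split=> [k _|]; rewrite ?mnm0E ?add0m.
have a0 : a = 0%MM by apply: (@addIm _ (val u)); rewrite add0m -{2}eu vu.
have Wu : W u = ((W u)@_0)%:MP.
  apply/mpolyP => b; rewrite mcoeffC.
  case: eqVneq => [->|b0]; first by rewrite mulr1.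
  rewrite mulr0; apply: memN_msupp_eq0; apply: contraNN b0 => bW.
  have [_ _ _ le0 _] := ord; apply/eqP.
  apply: esym; apply: (term_order_add_eq (a := val u) ord); first exact: le0.
  by rewrite addm0 addmC top.
have tu : u != t.
  apply/eqP => ut; move: ue; rewrite ut -{1}[val t]add0m => /addIm /eqP.
  by rewrite eq_sym mnm1_eq0.
pose h : mf_idx (U_resolution F 1) :=
  exist (fun p : mf_idx M * 'I_n.+1 => nonmult (mf_head p.1).2 p.2) (t, i) nmi.
apply: (F_minimal 1%N h u (- (W u)@_0)) => //.
  by rewrite oppr_eq0 -mcoeff_msupp -{1}vu -a0.
by rewrite /= ffunE (negbTE tu) sub0r -/M -/g -/W mpolyCN -Wu.
Qed.
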